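(* Let $X \subseteq S^9$ be such that $A(X) \subseteq \{\pm\frac{1}{5}, \pm\frac{3}{5}\}$ and $|X| \ge 256$. Assume that $X \cup (-X)$ contains no special triangle. Then $X \simeq X_{10}$.
   Context: $S^{n-1}$ is the unit sphere of $\mathbb{R}^n$ and $(\cdot,\cdot)$ the standard inner product. For $X \subseteq \mathbb{R}^n$, $A(X) := \{(x,x') \mid x,x' \in X,\ x \neq x'\}$. A special triangle in $X \cup (-X)$ is a triple $x_1,x_2,x_3 \in X \cup (-X)$ with $(x_1,x_2) = (x_2,x_3) = \frac{3}{5}$ and $(x_1,x_3) = -\frac{1}{5}$. Define $$X_{10} := \Bigl\{ \tfrac{1}{\sqrt{10}}\,[1, \epsilon_2, \dots, \epsilon_{10}] \in \mathbb{R}^{10} \;\Big|\; \epsilon_2,\dots,\epsilon_{10} \in \{1,-1\},\ \text{the total number of positive coordinates is even} \Bigr\},$$ so $|X_{10}| = 256$. For $X, X' \subseteq S^{d-1}$, $X \simeq X'$ (equivalence) means that $X'$ can be obtained from $X$ by applying an orthogonal transformation of $\mathbb{R}^d$ and replacing some of the vectors by their opposites. *)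

(* Defs.v *)
From mathcomp Require Import all_boot all_order all_algebra.
From mathcomp Require Import all_classical all_reals.

Set Implicit Arguments.
Unset Strict Implicit.
Unset Printing Implicit Defensive.

Import Order.TTheory GRing.Theory Num.Theory.

Local Open Scope classical_set_scope.
Local Open Scope ring_scope.

Section EuclideanSpace.
Context {R : realType} {n : nat}.
Implicit Types (u v x : 'rV[R]_n) (X Y : set 'rV[R]_n).

Definition dot u v : R := \sum_(i < n) u ord0 i * v ord0 i.

(* The Euclidean norm; MathComp-Analysis equips 'rV[R]_n with the sup norm. *)
Definition enorm u : R := Num.sqrt (dot u u).

(* In 'rV[R]_n this is the sphere S^(n-1). *)
Definition unit_sphere : set 'rV[R]_n := [set x | enorm x = 1].

(* A(X), the set of inner products of pairs of distinct vectors of X. *)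
Definition inner_products X : set R :=
  [set a | exists x y, [/\ X x, X y, x != y & a = dot x y]].

Definition sym_closure X : set 'rV[R]_n := X `|` [set - x | x in X].

Definition special_triangle x1 x2 x3 : Prop :=
  [/\ dot x1 x2 = 3 / 5, dot x2 x3 = 3 / 5 & dot x1 x3 = - (1 / 5)].

Definition has_special_triangle Y : Prop :=
  exists x1 x2 x3, [/\ Y x1, Y x2, Y x3 & special_triangle x1 x2 x3].

(* Matrices act on row vectors from the right. *)
Definition orthogonal_mx (Q : 'M[R]_n) : Prop := Q *m Q^T = 1%:M.

(* s marks the vectors of X whose image is replaced by its opposite. *)
Definition equivalent X Y : Prop :=
  exists (Q : 'M[R]_n) (s : 'rV[R]_n -> bool),
    orthogonal_mx Q /\ Y = [set (-1) ^+ s x *: (x *m Q) | x in X].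

End EuclideanSpace.

Definition X10 (R : realType) : set 'rV[R]_10 :=
  [set (Num.sqrt 10)^-1 *: e | e in
    [set e : 'rV[R]_10 | [/\ e ord0 ord0 = 1,
                             forall i, e ord0 i = 1 \/ e ord0 i = -1
                           & ~~ odd #|[set i : 'I_10 | (0 < e ord0 i)%R]%SET|]]].
Arguments X10 R _ : clear implicits.

(* Main.v *)
(** Scale the vectors to squared norm 5/2, so that their inner products become half odd integers,
    and let Y be the scaled closure of X under negation.

    If x, y in Y have inner product 3/2, then x - y has squared norm 2.  Since no triangle is special, such
    a "root" has inner product 0, 1 or -1 with every vector of Y, and the roots x - y with x fixed
    have pairwise inner products 0 or 1.  Among 256 vectors of X, the Welch bound provides an x with
    at least 45 such roots r_i.

    As in Musin's bound for two-distance sets, the 45 forms (r_i, .)^2 and the 10-dimensional space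
    of forms (x, .)(z, .) are independent, so they fill the 55-dimensional space of quadratic forms
    on R^10.  Expanding |v|^2 and (r_i, v)(r_j, v) in this basis gives the second moments of the
    r_i and, for orthogonal r_i and r_j, the sum of their common neighbours in the graph in which
    two roots are adjacent when their inner product is 1.  These identities force the graph to
    contain a 9-clique.  If S is the sum of the clique, then e_0 = (S - 2x)/8 and the differences
    of the clique vectors with e_0 form an orthonormal basis, and every e_i + e_j is one of the r_k.

    A vector of Y then has coordinates whose pairwise sums are 0, 1 or -1 and whose squares add up
    to 5/2, so all of them are 1/2 or -1/2.  The inner product with x = (e_0 + ... + e_9)/2 fixes
    the parity of the number of positive ones, and exactly 256 pairs of opposite sign vectors are
    left. *)

Require Import Defs.
From mathcomp Require Import all_boot all_order all_algebra.
From mathcomp Require Import all_classical all_reals.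
From mathcomp Require Import fintype finset ring lra zify.

Set Implicit Arguments.
Unset Strict Implicit.
Unset Printing Implicit Defensive.

Import Order.TTheory GRing.Theory Num.Theory.

Local Open Scope ring_scope.

(** * Bilinearity and definiteness of the inner product *)

Section DotProduct.
Context {R : realType} {n : nat}.
Implicit Types u v w : 'rV[R]_n.

Lemma dotC u v : dot u v = dot v u.
Proof. by apply: eq_bigr => i _; rewrite mulrC. Qed.

Lemma dotDl u v w : dot (u + v) w = dot u w + dot v w.
Proof. by rewrite -big_split; apply: eq_bigr => i _; rewrite mxE mulrDl. Qed.

Lemma dotDr u v w : dot w (u + v) = dot w u + dot w v.
Proof. by rewrite dotC dotDl !(dotC w). Qed.

Lemma dotZl a u v : dot (a *: u) v = a * dot u v.
Proof. by rewrite mulr_sumr; apply: eq_bigr => i _; rewrite mxE mulrA. Qed.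

Lemma dotZr a u v : dot u (a *: v) = a * dot u v.
Proof. by rewrite dotC dotZl dotC. Qed.

Lemma dotNl u v : dot (- u) v = - dot u v.
Proof. by rewrite -scaleN1r dotZl mulN1r. Qed.

Lemma dotNr u v : dot u (- v) = - dot u v.
Proof. by rewrite dotC dotNl dotC. Qed.

Lemma dotBl u v w : dot (u - v) w = dot u w - dot v w.
Proof. by rewrite dotDl dotNl. Qed.

Lemma dotBr u v w : dot w (u - v) = dot w u - dot w v.
Proof. by rewrite dotDr dotNr. Qed.

Lemma dot_suml (I : finType) (F : I -> 'rV[R]_n) v :
  dot (\sum_i F i) v = \sum_i dot (F i) v.
Proof.
rewrite exchange_big /=; apply: eq_bigr => i _.
by rewrite summxE mulr_suml.
Qed.

Lemma dot_sumr (I : finType) (F : I -> 'rV[R]_n) v :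
  dot v (\sum_i F i) = \sum_i dot v (F i).
Proof. by rewrite dotC dot_suml; apply: eq_bigr => i _; rewrite dotC. Qed.

Lemma dot_ge0 u : 0 <= dot u u.
Proof. by apply: sumr_ge0 => i _; rewrite -expr2 sqr_ge0. Qed.

Lemma dot_eq0 u : dot u u = 0 -> u = 0.
Proof.
move=> u0; apply/rowP => i; rewrite mxE.
have u_ge0 j : true -> 0 <= u ord0 j * u ord0 j by rewrite -expr2 sqr_ge0.
by have /(_ i isT)/eqP := psumr_eq0P u_ge0 u0; rewrite mulf_eq0 orbb => /eqP ->.
Qed.

Lemma dot_inj u v : (forall w, dot w u = dot w v) -> u = v.
Proof.
move=> uv; apply/subr0_eq/dot_eq0.
by rewrite dotBr uv subrr.
Qed.

Lemma dot_row_mul (E : 'M[R]_n) u i : (u *m E^T) ord0 i = dot u (row i E).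
Proof. by rewrite mxE; apply: eq_bigr => j _; rewrite !mxE. Qed.

End DotProduct.

Definition dotE := (@dotDl, @dotDr, @dotZl, @dotZr, @dotNl, @dotNr).

(** The dimension of the space of quadratic forms on R^10, counted by matrix entries on or above the
    diagonal. *)
Lemma card_leq_pairs10 : #|[pred p : 'I_10 * 'I_10 | (p.1 <= p.2)%N]| = 55%N.
Proof.
rewrite -sum1_card.
rewrite -(pair_big_dep predT (fun i j : 'I_10 => i <= j)%N (fun _ _ => 1%N)) /=.
under eq_bigr do rewrite big_mkcond.
by rewrite !big_ord_recl !big_ord0.
Qed.

(** * A 9-clique from the counting identities of the roots *)

Section NineClique.
Context {T : finType} {g : T -> T -> nat}.
Hypothesis g_sym : forall i j, g i j = g j i.
Hypothesis gii : forall i, g i i = 2%N.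
Hypothesis gij : forall i j, i != j -> (g i j <= 1)%N.
Hypothesis g_sum : forall i, (\sum_j g i j = 18)%N.
Hypothesis g_sum2 : forall i j, (\sum_k g i k * g j k = 8 * g i j + 4)%N.
Hypothesis g_sum3 : forall i j, g i j = 0%N ->
  forall k, (\sum_l g i l * g j l * g k l = 2 * (g i k + g j k))%N.

(** [g] stands for the Gram matrix of the roots: 2 on the diagonal, the adjacency matrix of a graph
    elsewhere. [N i] is the neighbourhood of [i] in this graph. *)
Let N i : {set T} := [set j | g i j == 1%N]%SET.

Let inN i j : (j \in N i) = (g i j == 1%N). Proof. by rewrite inE. Qed.

Let NC i j : (j \in N i) = (i \in N j). Proof. by rewrite !inN g_sym. Qed.

Let gE i j : g i j = (2 * (j == i) + (j \in N i))%N.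
Proof.
rewrite inN; have [->|] := eqVneq j i; first by rewrite gii.
by rewrite eq_sym => /gij; case: (g i j) => [|[|]].
Qed.

Let g_neq i j : g i j != 2 -> i != j.
Proof. by apply: contraNneq => ->; rewrite gii. Qed.

Let card_N i : #|N i| = 16%N.
Proof.
have := g_sum i; rewrite (bigD1 i) //= gii (eq_bigr (fun j => nat_of_bool (j \in N i))).
  rewrite -big_mkcondr sum1_card => /eqP; rewrite (eqn_add2l 2 _ 16) => /eqP <-.
  by apply: eq_card => j; rewrite [RHS]unfold_in inN; have [->|] := eqVneq j i; rewrite ?gii.
by move=> j /negPf ji; rewrite gE ji.
Qed.

(** The terms [k = i] and [k = j] each contribute [2 * g i j] to [g_sum2]. Adjacent vertices thus
    have 8 common neighbours, nonadjacent ones 4. *)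
Let card_N2 i j : i != j -> #|N i :&: N j| = (4 * g i j + 4)%N.
Proof.
move=> ij; have := g_sum2 i j.
rewrite (eq_bigr (fun k => 2 * g i j * (k == i) + 2 * g i j * (k == j) + (k \in N i :&: N j)))%N.
  rewrite !big_split /= -!big_distrr /= -!big_mkcond /= !big_pred1_eq sum1_card; lia.
move=> k _; rewrite in_setI !inN.
have [->|ki] := eqVneq k i.
  by rewrite (negPf ij) gii (g_sym j); lia.
have [->|kj] := eqVneq k j; first by rewrite gii; lia.
move: ki kj; rewrite !(eq_sym k) => /gij + /gij.
by case: (g i k) (g j k) => [|[|]] // [|[|]] // _ _; lia.
Qed.

Let sum_N2 i j k : g i j = 0%N ->
  (\sum_(l in N i :&: N j) g k l = 2 * (g i k + g j k))%N.
Proof.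
move=> ij0; rewrite -(g_sum3 ij0) big_mkcond; apply: eq_bigr => l _ /=.
rewrite in_setI !inN.
have [<-|il] := eqVneq i l; first by rewrite (g_sym j) ij0 gii muln0.
have [<-|jl] := eqVneq j l; first by rewrite ij0.
by case: (g i l) (gij il) (g j l) (gij jl) => [|[|]] // _ [|[|]] // _; rewrite ?mul1n ?mul0n.
Qed.

(** Inside the four common neighbours of [i] and [j] every row of [g] sums to 4, so each vertex has
    exactly two neighbours there. A triangle would leave the fourth vertex isolated. *)
Let no_common_triangle i j a b c : g i j = 0%N ->
  a \in N i :&: N j -> b \in N i :&: N j -> c \in N i :&: N j ->
  g a b = 1%N -> g a c = 1%N -> g b c = 1%N -> False.
Proof.
move=> ij0 aM bM cM ab ac bc; set M := N i :&: N j in aM bM cM.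
have ij : i != j by rewrite g_neq ?ij0.
have M4 : #|M| = 4%N by rewrite card_N2 // ij0.
have sumM k : k \in M -> (\sum_(l in M) g k l = 4)%N.
  by rewrite sum_N2 // in_setI !inN => /andP[/eqP -> /eqP ->].
have bMa : b \in M :\ a by rewrite in_setD1 bM eq_sym g_neq ?ab.
have cMab : c \in M :\ a :\ b.
  by rewrite !in_setD1 cM !(eq_sym c) !g_neq ?ac ?bc.
have : #|M :\ a :\ b :\ c| == 1%N.
  by have := M4; rewrite (cardsD1 a) aM (cardsD1 b) bMa (cardsD1 c) cMab => /eqP.
case/cards1P => d Md.
have gs k : k \in M -> (g k a + (g k b + (g k c + g k d)) = 4)%N.
  by move/sumM; rewrite (big_setD1 a) //= (big_setD1 b) //= (big_setD1 c) //= Md big_set1.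
have dM : d \in M.
  have : d \in M :\ a :\ b :\ c by rewrite Md set11.
  by rewrite !in_setD1 => /and4P[].
have := gs a aM; have := gs b bM; have := gs c cM; have := gs d dM.
rewrite !gii (g_sym b a) (g_sym c a) (g_sym c b) ab ac bc !(g_sym d); lia.
Qed.

Let card_N3 i j k : g i j = 0%N -> k \in N i :&: N j -> #|N i :&: N j :&: N k| = 2%N.
Proof.
move=> ij0 kM; have := sum_N2 k ij0.
move: (kM); rewrite in_setI !inN => /andP[/eqP -> /eqP ->].
rewrite (big_setD1 k) //= gii (eq_bigr (fun l => nat_of_bool (l \in N k))).
  rewrite -big_mkcondr sum1_card => /eqP; rewrite (eqn_add2l 2 _ 2) => /eqP <-.
  apply: eq_card => l; rewrite [in LHS]in_setI [RHS]unfold_in in_setD1 -andbA.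
  by have [->|] := eqVneq l k; rewrite // (inN k) gii andbF.
by move=> l; rewrite in_setD1 => /andP[/negPf lk _]; rewrite gE lk.
Qed.

(** If every [p] in [D] had at most 5 neighbours in [D], its 8 common neighbours with [r] would
    number at most 1 (for [s]) plus 5 plus its neighbours in [E]. Summing over the 8 vertices of
    [D], with 14 edges between [D] and [E], gives 64 <= 48 + 14. *)
Let large_neighbourhood r s : g r s = 1%N ->
  exists2 p, p \in N r :&: N s & (6 <= #|N r :&: N s :&: N p|)%N.
Proof.
move=> rs; set D := N r :&: N s; pose E := N r :\: N s :\ s.
have D8 : #|D| = 8%N by rewrite card_N2 ?g_neq ?rs.
have sNr : s \in N r by rewrite inN rs.
have s_notin : s \notin N s by rewrite inN gii.
have splitN (A : {set T}) : A \subset N r ->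
    #|A| = ((s \in A) + #|D :&: A| + #|E :&: A|)%N.
  move=> Ar; rewrite -(cardsID (N s) A) (cardsD1 s (A :\: N s)) in_setD s_notin /= addnCA.
  rewrite -addnA; congr (_ + (_ + _))%N.
    by rewrite /D -setIA [N s :&: A]setIC setIA (setIidPr Ar).
  apply: eq_card => l; rewrite in_setI !in_setD1 !in_setD.
  by case lA: (l \in A); rewrite ?andbT ?andbF // (subsetP Ar _ lA) andbT.
have Dr : D \subset N r by apply: subsetIl.
have Er : E \subset N r by apply: subset_trans (subD1set _ _) (subsetDl _ _).
have E7 : #|E| = 7%N.
  by have := splitN _ (subxx _); rewrite card_N sNr (setIidPl Dr) (setIidPl Er) D8; lia.
have sumE : (\sum_(p in D) #|E :&: N p| = 14)%N.
  transitivity (\sum_(t in E) 2)%N; last by rewrite sum_nat_const E7.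
  transitivity (\sum_(p in D) \sum_(t in E | p \in N t) 1)%N.
    apply: eq_bigr => p _; rewrite sum1_card; apply: eq_card => t.
    by rewrite [RHS]unfold_in in_setI NC.
  rewrite (exchange_big_dep (mem E)) /=; last by move=> p t _ /andP[].
  apply: eq_bigr => t; rewrite in_setD1 in_setD => /and3P[ts st rt].
  (* [r] is a common neighbour of the nonadjacent [s] and [t], so [card_N3] gives [t] exactly two
     neighbours in [D]. *)
  have st0 : g s t = 0%N by rewrite gE (negPf ts) (negPf st).
  rewrite sum1_card -(@card_N3 s t r) //; last by rewrite in_setI NC sNr NC.
  apply: eq_card => p; rewrite [LHS]unfold_in ts st rt /D !in_setI /=.
  by rewrite [RHS]andbC andbA.
case: (boolP [exists p in D, (6 <= #|D :&: N p|)%N]) => [/exists_inP//|].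
rewrite negb_exists_in => /forall_inP small.
have : (\sum_(p in D) #|N r :&: N p| <= \sum_(p in D) (6 + #|E :&: N p|))%N.
  apply: leq_sum => p pD; rewrite (splitN _ (subsetIl _ _)) !setIA (setIidPl Dr) (setIidPl Er) leq_add2r.
  by rewrite -(add1n 5) leq_add ?leq_b1 // -ltnS ltnNge small.
rewrite big_split /= sumE sum_nat_const D8.
rewrite (eq_bigr (fun=> 8%N)) ?sum_nat_const ?D8 // => p.
by rewrite in_setI => /andP[pr _]; rewrite card_N2 ?g_neq //; move: pr; rewrite inN => /eqP ->.
Qed.

(** An edge [r s], a vertex [p] joined to both, and six or more common neighbours of all three form
    a clique: two nonadjacent vertices among the latter would have the triangle [r], [s], [p] in
    their common neighbourhood. *)
Lemma nine_clique (r : T) : exists v : 'I_9 -> T, forall k l, k != l -> g (v k) (v l) = 1%N.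
Proof.
have [s rs] : exists s, s \in N r by apply/set0Pn; rewrite -card_gt0 card_N.
move: rs; rewrite inN => /eqP rs.
have [p pD p6] := large_neighbourhood rs.
move: (pD); rewrite in_setI !inN => /andP[/eqP rp /eqP sp].
set Q := N r :&: N s :&: N p in p6.
have inQ a : a \in Q -> [/\ g r a = 1%N, g s a = 1%N & g p a = 1%N].
  by rewrite !in_setI !inN => /andP[/andP[/eqP-> /eqP->] /eqP->].
pose A := r |: (s |: (p |: Q)).
have A9 : (9 <= #|A|)%N.
  have notinQ a : g r a != 1%N \/ g s a != 1%N \/ g p a != 1%N -> a \notin Q.
    by move=> H; apply/negP => /inQ[]; case: H => [|[|]] /eqP.
  rewrite /A !cardsU1 !in_setU1 !negb_or !g_neq ?rs ?rp ?sp //=.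
  rewrite !notinQ ?gii; by [lia|left|right; left|right; right].
have A_clique a b : a \in A -> b \in A -> a != b -> g a b = 1%N.
  rewrite !in_setU1 => /or4P[/eqP->|/eqP->|/eqP->|/inQ[ra sa pa]]
    /or4P[/eqP->|/eqP->|/eqP->|/inQ[rb sb pb]];
    rewrite ?eqxx // => ab; try by rewrite 1?g_sym.
  case gab : (g a b) (gij ab) => [|[|]] // _.
  by case: (@no_common_triangle a b r s p gab);
    rewrite ?in_setI ?inN ?(g_sym a) ?(g_sym b) ?ra ?rb ?sa ?sb ?pa ?pb.
exists (fun k => enum_val (widen_ord A9 k)) => k l kl.
apply: A_clique; rewrite ?enum_valP // (inj_eq enum_val_inj).
by apply: contra_neq kl => /(congr1 val)/= kl; apply: val_inj.
Qed.

End NineClique.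

(** * Rank-one matrices *)

Lemma mul_rank1 (R : realType) n (u v w : 'rV[R]_n) :
  v *m (u^T *m w) = dot v u *: w.
Proof.
apply/rowP => b; rewrite mulmxA !mxE big_ord1 !mxE; congr (_ * _).
by apply: eq_bigr => a _; rewrite mxE.
Qed.

Lemma mxtrace_rank1 (R : realType) n (u w : 'rV[R]_n) : \tr (u^T *m w) = dot u w.
Proof. by apply: eq_bigr => a _; rewrite !mxE big_ord1 mxE. Qed.

Lemma sum_mul_delta (R : realType) n (F : 'I_n -> R) (p : 'I_n) :
  \sum_a F a * (a == p)%:R = F p.
Proof.
rewrite (bigD1 p) //= eqxx mulr1 big1 ?addr0 // => a /negPf ->.
by rewrite mulr0.
Qed.

(** * The 45 roots as a basis of quadratic forms, and the orthonormal basis they yield *)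

Section RootConfiguration.
Context {R : realType} {x : 'rV[R]_10} {r : 'I_45 -> 'rV[R]_10}
  {g : 'I_45 -> 'I_45 -> nat}.
Hypothesis x_norm : dot x x = 5 / 2.
Hypothesis rx : forall i, dot (r i) x = 1.
Hypothesis rr : forall i j, dot (r i) (r j) = (g i j)%:R.
Hypothesis gii : forall i, g i i = 2%N.
Hypothesis gij : forall i j, i != j -> (g i j <= 1)%N.
Implicit Types (c : 'I_45 -> R) (z v w : 'rV[R]_10) (S : 'M[R]_10).

(** The matrix of the quadratic form sum_i c_i (r_i, v)^2 - 2 (x, v)(z, v). *)
Definition expansion c z : 'M[R]_10 :=
  \sum_i c i *: ((r i)^T *m r i) - (x^T *m z + z^T *m x).

Lemma expansion_trace c z : \tr (expansion c z) = 2 * (\sum_i c i) - 2 * dot x z.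
Proof.
rewrite linearB linearD /= !mxtrace_rank1 (dotC z) linear_sum /=.
under eq_bigr do rewrite linearZ /= mxtrace_rank1 rr gii.
rewrite -mulr_suml; ring.
Qed.

Lemma expansion_form c z v w :
  dot (v *m expansion c z) w =
  \sum_i c i * (dot (r i) v * dot (r i) w) - (dot v x * dot z w + dot v z * dot x w).
Proof.
rewrite mulmxBr mulmxDr !mul_rank1 mulmx_sumr !dotE dot_suml.
congr (_ - _); apply: eq_bigr => i _.
by rewrite -scalemxAr mul_rank1 !dotE (dotC v).
Qed.

Lemma expansion_sym c z : (expansion c z)^T = expansion c z.
Proof.
rewrite /expansion linearB linearD /= !trmx_mul !trmxK (addrC (z^T *m x)).
congr (_ - _).
rewrite linear_sum; apply: eq_bigr => i _.
by rewrite linearZ /= trmx_mul trmxK.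
Qed.

(** Entries 0 and 1 are idempotent, and 4 = 2 + 2 on the diagonal. This makes the squares in
    [expansion_row] linear. *)
Lemma g_sqr i j : (g i j)%:R ^+ 2 = (g i j)%:R + (j == i)%:R * 2 :> R.
Proof.
have [->|ij] := eqVneq j i; first by rewrite gii mul1r; ring.
by rewrite eq_sym in ij; case: (g i j) (gij ij) => [|[|]] // _; rewrite ?expr0n ?expr1n ?mul0r ?addr0.
Qed.

Lemma expansion_row c z i :
  dot (r i *m expansion c z) (r i) =
  2 * c i + \sum_j c j * dot (r j) (r i) - 2 * dot (r i) z.
Proof.
rewrite expansion_form rx (dotC z) (dotC x) rx.
suff -> : \sum_j c j * (dot (r j) (r i) * dot (r j) (r i)) =
   2 * c i + \sum_j c j * dot (r j) (r i) by ring.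
have <- := sum_mul_delta (fun j => 2 * c j) i.
rewrite -big_split; apply: eq_bigr => j _ /=.
rewrite -expr2 rr g_sqr eq_sym; ring.
Qed.

Lemma expansion_x c z v :
  dot (x *m expansion c z) v =
  \sum_i c i * dot (r i) v - (5 / 2 * dot z v + dot x z * dot x v).
Proof.
by rewrite expansion_form x_norm; under eq_bigr do rewrite rx mul1r.
Qed.

(** The trace and the value at [x] give (x, z) = 0. The row at [x] and the values at the [r i] then
    give c_i = -(r_i, z)/4, so that sum_i c_i^2 + 5/8 |z|^2 = 0. *)
Lemma expansion_inj0 c z : expansion c z = 0 -> (forall i, c i = 0) /\ z = 0.
Proof.
move=> E0.
have := expansion_trace c z; rewrite E0 linear0 => tr0.
have form0 v w : 0 = dot (v *m expansion c z) w.
  by rewrite E0 mulmx0 -(scale0r 0) dotZl mul0r.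
have xx0 := form0 x x; rewrite expansion_x x_norm (dotC z) in xx0.
rewrite (eq_bigr c) in xx0; last by move=> i _; rewrite rx mulr1.
have xz0 : dot x z = 0 by lra.
have comb v : \sum_i c i * dot (r i) v = 5 / 2 * dot z v.
  by have := form0 x v; rewrite expansion_x xz0; lra.
have ci i : c i = - (1 / 4) * dot (r i) z.
  by have := form0 (r i) (r i); rewrite expansion_row comb (dotC z); lra.
have sq : \sum_i c i * c i + 5 / 8 * dot z z = 0.
  rewrite -[5 / 8](_ : 1 / 4 * (5 / 2) = _); last by lra.
  rewrite -mulrA -comb mulr_sumr -big_split big1 // => i _ /=.
  by rewrite {2}ci; ring.
have c2_ge0 : 0 <= \sum_i c i * c i by apply: sumr_ge0 => i _; rewrite -expr2 sqr_ge0.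
have z2_ge0 := dot_ge0 z.
have z0 : z = 0 by apply: dot_eq0; lra.
by split=> // i; rewrite ci z0 -(scale0r 0) dotZr mul0r mulr0.
Qed.

(** An injective linear map from dimension 45 + 10 into the 55-dimensional space of symmetric
    matrices is onto. *)
Lemma expansion_surj S : S^T = S -> exists c z, S = expansion c z.
Proof.
move=> S_sym.
pose P := [pred p : 'I_10 * 'I_10 | (p.1 <= p.2)%N].
(* [co] lists the entries on or above the diagonal, which determine a symmetric matrix. *)
pose co (A : 'M[R]_10) : 'rV_#|P| := \row_k A (enum_val k).1 (enum_val k).2.
have co_inj A B : A^T = A -> B^T = B -> co A = co B -> A = B.
  move=> A_sym B_sym /rowP AB; apply/matrixP.
  have AB_le (a b : 'I_10) : (a <= b)%N -> A a b = B a b.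
    move=> ab; have Pab : (a, b) \in P by [].
    by have := AB (enum_rank_in Pab (a, b)); rewrite !mxE enum_rankK_in.
  move=> a b; have [/AB_le //|/ltnW/AB_le ba] := leqP a b.
  by rewrite -A_sym -B_sym !mxE.
pose B1 : 'M[R]_(45, #|P|) := \matrix_i co ((r i)^T *m r i).
pose B2 : 'M[R]_(10, #|P|) := \matrix_i co (- (x^T *m delta_mx ord0 i + (delta_mx ord0 i)^T *m x)).
have mulB (u : 'rV_(45 + 10)) :
    u *m col_mx B1 B2 = co (expansion (fun i => lsubmx u ord0 i) (rsubmx u)).
  rewrite -{1}[u]hsubmxK mul_row_col; apply/rowP => k; rewrite !mxE summxE.
  congr (_ + _).
    by apply: eq_bigr => i _; rewrite !mxE !big_ord1 !mxE.
  rewrite !big_ord1 !mxE.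
  set a := (enum_val k).1; set b := (enum_val k).2.
  rewrite -(sum_mul_delta (fun i => u ord0 (rshift 45 i)) a).
  rewrite -(sum_mul_delta (fun i => u ord0 (rshift 45 i)) b).
  rewrite mulr_suml mulr_sumr -big_split -sumrN; apply: eq_bigr => i _ /=.
  rewrite !mxE !big_ord1 !mxE eqxx /= -/a -/b !(eq_sym _ i).
  ring.
have B_free : row_free (col_mx B1 B2).
  apply: inj_row_free => u /eqP; rewrite mulB => /eqP co0.
  have /expansion_inj0[c0 z0] :
      expansion (fun i => lsubmx u ord0 i) (rsubmx u) = 0.
    apply: co_inj; rewrite ?expansion_sym ?trmx0 // co0.
    by apply/rowP => k; rewrite !mxE.
  rewrite -[u]hsubmxK z0 (_ : lsubmx u = 0) ?row_mx0 //.
  by apply/rowP => i; rewrite c0 mxE.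
have B_full : row_full (col_mx B1 B2).
  by rewrite /row_full (eqP B_free) card_leq_pairs10.
have /submxP[u co_u] := submx_full (co S) B_full.
exists (fun i => lsubmx u ord0 i), (rsubmx u).
by apply: co_inj; rewrite ?expansion_sym // co_u mulB.
Qed.

(** The expansion of the identity matrix turns out to have c_i = 1/8 and z = x/4. Its row at [x] and
    its bilinear form are the two claims. *)
Lemma root_sum_frame :
  \sum_i r i = 18 *: x /\
  forall v w, \sum_i dot (r i) v * dot (r i) w = 8 * dot v w + 4 * dot v x * dot w x.
Proof.
have [c [z E1]] : exists c z, 1%:M = expansion c z.
  by apply: expansion_surj; rewrite trmx1.
have := expansion_trace c z; rewrite -E1 mxtrace1 => trE.
have form v w := expansion_form c z v w; rewrite -E1 in form.
have formx v := expansion_x c z v; rewrite -E1 mulmx1 in formx.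
have formr i : 2 = 2 * c i + \sum_j c j * dot (r j) (r i) - 2 * dot (r i) z.
  by rewrite -expansion_row -E1 mulmx1 rr gii.
have xx := formx x.
rewrite x_norm (dotC z) (eq_bigr c) in xx; last by move=> i _; rewrite rx mulr1.
have xz : dot x z = 5 / 8 by lra.
have comb v : \sum_i c i * dot (r i) v = 13 / 8 * dot x v + 5 / 2 * dot z v.
  by have := formx v; rewrite xz; lra.
(* [y] is the deviation from the expected z = x/4. It vanishes because a positive combination of
   squares in [y] is zero. *)
have [y zE] : exists y, z = (1 / 4) *: x + y.
  by exists (z - (1 / 4) *: x); rewrite addrC subrK.
have xy : dot x y = 0 by move: xz; rewrite zE !dotE x_norm; lra.
have ci i : c i = 1 / 8 - 1 / 4 * dot (r i) y.
  have := formr i; rewrite comb (dotC x) (dotC z) rx zE !dotE rx; lra.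
have sum_c : \sum_i c i = 45 / 8 by lra.
have sum_ry : \sum_i dot (r i) y = 0.
  move: sum_c; rewrite (eq_bigr (fun i => 1 / 8 - 1 / 4 * dot (r i) y)) //.
  by rewrite sumrB sumr_const card_ord -mulr_sumr -mulr_natr; lra.
have sq : \sum_i dot (r i) y * dot (r i) y + 10 * dot y y = 0.
  have := comb y; rewrite xy zE !dotE xy.
  rewrite (eq_bigr (fun i => 1 / 8 * dot (r i) y - 1 / 4 * (dot (r i) y * dot (r i) y))).
    by rewrite sumrB -!mulr_sumr sum_ry; lra.
  by move=> i _; rewrite ci; ring.
have ry2_ge0 : 0 <= \sum_i dot (r i) y * dot (r i) y.
  by apply: sumr_ge0 => i _; rewrite -expr2 sqr_ge0.
have y2_ge0 := dot_ge0 y.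
have y0 : y = 0 by apply: dot_eq0; lra.
have c8 i : c i = 1 / 8 by rewrite ci y0 -(scale0r 0) dotZr mul0r mulr0 subr0.
rewrite zE y0 addr0 in form formx.
split.
  apply: dot_inj => v; rewrite dotC dot_suml (dotC v) dotZl.
  have := formx v; rewrite dotZl; under eq_bigr do rewrite c8.
  by rewrite -mulr_sumr; rewrite dotZr x_norm; lra.
move=> v w; have := form v w; rewrite mulmx1; under eq_bigr do rewrite c8.
by rewrite -mulr_sumr !dotE (dotC w); lra.
Qed.

Let root_sum := root_sum_frame.1.
Let frame := root_sum_frame.2.

Lemma g_sym i j : g i j = g j i.
Proof. by apply/eqP; rewrite -(eqr_nat R) -!rr dotC. Qed.

Lemma g_sum i : (\sum_j g i j = 18)%N.
Proof.
apply/eqP; rewrite -(eqr_nat R) natr_sum; under eq_bigr do rewrite -rr.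
by rewrite -dot_sumr root_sum dotZr rx mulr1.
Qed.

Lemma g_sum2 i j : (\sum_k g i k * g j k = 8 * g i j + 4)%N.
Proof.
apply/eqP; rewrite -(eqr_nat R) natr_sum natrD natrM -rr.
have := frame (r i) (r j); rewrite !rx !mulr1 => <-.
by apply/eqP/eq_bigr => k _; rewrite natrM -!rr !(dotC (r k)).
Qed.

(** The expansion of the symmetrised product of [r i] and [r j] shows that their common neighbours
    sum to 2 (r_i + r_j). Pairing with [r k] gives the identity. *)
Lemma g_sum3 i j : g i j = 0%N ->
  forall k, (\sum_l g i l * g j l * g k l = 2 * (g i k + g j k))%N.
Proof.
move=> gij0.
have [c [z E1]] : exists c z, (r i)^T *m r j + (r j)^T *m r i = expansion c z.
  by apply: expansion_surj; rewrite linearD /= !trmx_mul !trmxK addrC.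
pose s k := dot (r i) (r k); pose t k := dot (r j) (r k).
have s_idem k : i != k -> s k * s k = s k.
  move=> ik; rewrite /s rr; case: (g i k) (gij ik) => [|[|]] // _.
    by rewrite mul0r.
  by rewrite mul1r.
have t_idem k : j != k -> t k * t k = t k.
  move=> jk; rewrite /t rr; case: (g j k) (gij jk) => [|[|]] // _.
    by rewrite mul0r.
  by rewrite mul1r.
have sj0 : s j = 0 by rewrite /s rr gij0.
have ti0 : t i = 0 by rewrite /t dotC.
(* At [k = i], where [s] is 2 and not idempotent, [t] vanishes; likewise for [t] at [k = j]. So
   [s k * t k] is the indicator of the common neighbours. *)
have sst k : s k * (s k * t k) = s k * t k.
  have [<-|/s_idem sk] := eqVneq i k; first by rewrite ti0 !mulr0.
  by rewrite mulrA sk.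
have stt k : (s k * t k) * t k = s k * t k.
  have [<-|/t_idem tk] := eqVneq j k; first by rewrite sj0 !mul0r.
  by rewrite -mulrA tk.
have sum_st : \sum_k s k * t k = 4.
  rewrite (eq_bigr (fun k => dot (r k) (r i) * dot (r k) (r j))).
    by rewrite frame !rx rr gij0; lra.
  by move=> k _; rewrite !(dotC (r k)).
have E v w : dot (v *m expansion c z) w =
    dot (r i) v * dot (r j) w + dot (r j) v * dot (r i) w.
  by rewrite -E1 mulmxDr !mul_rank1 !dotE !(dotC v).
have := expansion_trace c z; rewrite -E1 linearD /= !mxtrace_rank1 (dotC (r j)) rr gij0 => trE.
have xx := expansion_x c z x.
rewrite E !rx x_norm (dotC z) (eq_bigr c) in xx; last by move=> k _; rewrite rx mulr1.
have xz : dot x z = - (1 / 2) by lra.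
have comb v : \sum_k c k * dot (r k) v =
    dot (r i) v + dot (r j) v + 5 / 2 * dot z v - 1 / 2 * dot x v.
  by have := expansion_x c z v; rewrite E !rx xz; lra.
have ck k : 2 * c k = 2 * (s k * t k) - s k - t k + 1 / 2 - 1 / 2 * dot (r k) z.
  have := expansion_row c z k; rewrite E comb -/(s k) -/(t k) (dotC x) rx (dotC z); lra.
have [y yE] : exists y, forall v, dot y v = \sum_k s k * t k * dot (r k) v.
  exists (\sum_k (s k * t k) *: r k) => v.
  by rewrite dot_suml; apply: eq_bigr => k _; rewrite dotZl.
(* Substituting [ck] into [comb] leaves, besides [y] itself, only first and second moments of the
   roots, known from [root_sum] and [frame]. *)
have zE v : 9 * dot z v = 2 * dot y v - 10 * (dot (r i) v + dot (r j) v) + 3 * dot x v.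
  have := comb v.
  have -> : \sum_k c k * dot (r k) v = dot y v - 1 / 2 * \sum_k s k * dot (r k) v
     - 1 / 2 * (\sum_k t k * dot (r k) v) + 1 / 4 * dot (\sum_k r k) v
     - 1 / 4 * \sum_k dot (r k) z * dot (r k) v.
    rewrite yE dot_suml !mulr_sumr -!sumrN -!big_split; apply: eq_bigr => k _ /=.
    have -> : c k = (2 * c k) / 2 by lra.
    by rewrite ck; lra.
  rewrite frame root_sum dotZl /s /t.
  under eq_bigr do rewrite dotC.
  under [in X in _ - _ * X + _]eq_bigr do rewrite dotC.
  rewrite !frame !rx (dotC z x) xz (dotC v x); lra.
have yi : dot y (r i) = 4.
  rewrite yE -sum_st; apply: eq_bigr => k _.
  by rewrite (dotC (r k)) mulrC sst.
have yj : dot y (r j) = 4.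
  by rewrite yE -sum_st; apply: eq_bigr => k _; rewrite (dotC (r k)) stt.
have yx : dot y x = 4.
  by rewrite yE -sum_st; apply: eq_bigr => k _; rewrite rx mulr1.
have yz : 9 * dot y z = 2 * dot y y - 68.
  by rewrite (dotC y z) zE !(dotC _ y) yi yj yx; lra.
have zij : 9 * (dot z (r i) + dot z (r j)) = - 18.
  by rewrite mulrDr !zE yi yj !(dotC x) !rx (dotC (r j)) !rr !gii gij0; lra.
(* The value of the form at the pair [r i], [r j] fixes |y|^2, after which y - 2 (r_i + r_j) has
   norm 0. *)
have yy : dot y y = 16.
  have := expansion_form c z (r i) (r j).
  rewrite E !rr !gii gij0 rx (dotC x) rx.
  have -> : \sum_k c k * (dot (r k) (r i) * dot (r k) (r j)) =
      1 / 4 * (\sum_k s k * t k) - 1 / 4 * dot y z.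
    rewrite yE !mulr_sumr -sumrB; apply: eq_bigr => k _.
    rewrite !(dotC (r k)) -/(s k) -/(t k).
    have -> : c k = (2 * c k) / 2 by lra.
    rewrite ck; have := sst k; have := stt k => h1 h2.
    have : s k * (s k * t k) * t k = s k * t k by rewrite h2 h1.
    rewrite (dotC z); lra.
  by rewrite sum_st (dotC (r i) z); lra.
have y2 : y = 2 *: (r i + r j).
  apply/subr0_eq/dot_eq0.
  rewrite dotBl !dotBr yy !dotE !(dotC _ y) yi yj (dotC (r j)) !rr !gii gij0; lra.
move=> k; apply/eqP; rewrite -(eqr_nat R) natrM natrD -!rr natr_sum.
rewrite -dotDl -dotZl -y2 yE; apply/eqP/eq_bigr => l _.
by rewrite !natrM -!rr (dotC (r k)).
Qed.

Lemma root_basis : exists e : 'I_10 -> 'rV[R]_10,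
  [/\ forall i j, dot (e i) (e j) = (i == j)%:R,
      forall i, dot (e i) x = 1 / 2
    & forall i j, i != j -> exists k, r k = e i + e j].
Proof.
have [v v_clique] := nine_clique g_sym gii gij g_sum g_sum2 g_sum3 ord0.
have vv k l : dot (r (v k)) (r (v l)) = 1 + (k == l)%:R.
  rewrite rr; have [->|kl] := eqVneq k l; first by rewrite gii.
  by rewrite v_clique // addr0.
have v_inj : injective v.
  move=> k l vkl; apply/eqP/negPn/negP => /v_clique; by rewrite vkl gii.
have sv k : dot (\sum_l r (v l)) (r (v k)) = 10.
  rewrite dot_suml; under eq_bigr do rewrite vv.
  rewrite big_split /= sumr_const card_ord (bigD1 k) //= eqxx big1 ?addr0 -?natrD //.
  by move=> l /negPf ->.
have sx : dot (\sum_l r (v l)) x = 9.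
  by rewrite dot_suml; under eq_bigr do rewrite rx; rewrite sumr_const card_ord.
(* In the intended basis the clique consists of the e_0 + e_k and 2x is the sum of all e_i, so the
   clique sum minus 2x is 8 e_0. *)
have [e0 e0E] : exists e0, e0 = (1 / 8) *: (\sum_l r (v l) - 2 *: x) by eexists.
have e0r k : dot e0 (r (v k)) = 1.
  by rewrite e0E !(dotZl, dotBl) sv (dotC x) rx; lra.
have e0x : dot e0 x = 1 / 2 by rewrite e0E !(dotZl, dotBl) sx x_norm; lra.
have e00 : dot e0 e0 = 1.
  by rewrite {2}e0E !(dotZr, dotBr) e0x dot_sumr; under eq_bigr do rewrite e0r;
    rewrite sumr_const card_ord; lra.
(* By [frame] the squares (r_i, e_0)^2 add up to 9, which the clique already exhausts. *)
have e0_other l : (forall k, v k != l) -> dot e0 (r l) = 0.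
  move=> l_notin.
  have := frame e0 e0; rewrite e00 e0x.
  rewrite (bigID (mem (codom v))) /=.
  have -> : \sum_(i in codom v) dot (r i) e0 * dot (r i) e0 = 9.
    rewrite (eq_bigr (fun=> 1)); last by move=> _ /codomP[k ->]; rewrite dotC e0r mulr1.
    by rewrite sumr_const card_codom // card_ord.
  move=> sum9.
  have : \sum_(i | i \notin codom v) dot (r i) e0 * dot (r i) e0 = 0 by lra.
  have sq_ge0 i : i \notin codom v -> 0 <= dot (r i) e0 * dot (r i) e0.
    by rewrite -expr2 sqr_ge0.
  move/(psumr_eq0P sq_ge0)/(_ l) => H; apply/eqP.
  rewrite dotC -sqrf_eq0 expr2 H //; apply/codomP => -[k lk].
  by have := l_notin k; rewrite lk eqxx.
pose e i := if unlift ord0 i is Some k then r (v k) - e0 else e0.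
have e_lift k : e (lift ord0 k) = r (v k) - e0 by rewrite /e liftK.
have e_0 : e ord0 = e0 by rewrite /e unlift_none.
have e_orth i j : dot (e i) (e j) = (i == j)%:R.
  case: (unliftP ord0 i) => [k|] ->; case: (unliftP ord0 j) => [l|] ->;
    rewrite ?e_lift ?e_0 ?(inj_eq lift_inj) ?eqxx //= ?(eq_sym _ ord0) ?neq_lift.
  - rewrite dotBl !dotBr vv e00 (dotC _ e0) !e0r; lra.
  - by rewrite dotBl e00 dotC e0r subrr.
  - by rewrite dotBr e00 e0r subrr.
have e_x i : dot (e i) x = 1 / 2.
  by case: (unliftP ord0 i) => [k|] ->; rewrite ?e_lift ?e_0 // dotBl rx e0x; lra.
clearbody e; exists e; split=> // i j.
case: (unliftP ord0 i) => [k|] ->; case: (unliftP ord0 j) => [l|] ->; rewrite ?e_lift ?e_0 ?eqxx //.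
- rewrite (inj_eq lift_inj) => kl.
  (* The sum being nonzero, some root meets both basis vectors. No clique member does, so this root
     is orthogonal to e_0, both inner products are 1, and its distance to the sum of the two vectors
     is 0. *)
  have : \sum_m dot (r m) (e (lift ord0 k)) * dot (r m) (e (lift ord0 l)) = 1.
    by rewrite frame e_orth !e_x (inj_eq lift_inj) (negPf kl) /=; lra.
  case: (pickP (fun m => dot (r m) (e (lift ord0 k)) * dot (r m) (e (lift ord0 l)) != 0)); last first.
    by move=> zero; rewrite big1 => [|m _]; [lra|exact/eqP/negbFE/zero].
  move=> m; rewrite mulf_eq0 negb_or !e_lift => /andP[mk ml] _; exists m.
  have m_notin n : v n != m.
    apply/eqP => mn; move: mk ml; rewrite -mn !dotBr (dotC _ e0) e0r !vv.
    rewrite !(addrC 1) !addrK !pnatr_eq0 !eqb0 !negbK => /eqP -> kl'.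
    by rewrite kl' in kl.
  have rm n : dot (r m) (r (v n) - e0) != 0 -> dot (r m) (r (v n) - e0) = 1.
    rewrite dotBr (dotC _ e0) e0_other // subr0 rr.
    by have := m_notin n; rewrite eq_sym => /gij; case: (g m (v n)) => [|[|]]; rewrite ?eqxx.
  apply/subr0_eq/dot_eq0; rewrite -!e_lift.
  rewrite dotBl !dotBr !dotDl !dotDr !e_orth !(dotC (e _)) !e_lift (rm k mk) (rm l ml) rr gii.
  rewrite !(inj_eq lift_inj) !eqxx (eq_sym l) (negPf kl) /=; lra.
- by exists (v k); rewrite subrK.
- by exists (v l); rewrite addrC subrK.
Qed.

End RootConfiguration.

(** * The Welch bound *)

Lemma welch_bound (R : realType) n m (f : 'I_m -> 'rV[R]_n) :
  (\sum_i dot (f i) (f i)) ^+ 2 <= n%:R * \sum_i \sum_j dot (f i) (f j) ^+ 2.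
Proof.
case: n f => [|n'] f.
  by rewrite mul0r big1 ?expr0n // => i _; rewrite /dot big_ord0.
set d := n'.+1 in f *; pose M := \sum_i (f i)^T *m f i.
have trM : \tr M = \sum_i dot (f i) (f i).
  by rewrite linear_sum; apply: eq_bigr => i _; rewrite /= mxtrace_rank1.
have trM2 : \tr (M *m M) = \sum_i \sum_j dot (f i) (f j) ^+ 2.
  rewrite mulmx_suml linear_sum; apply: eq_bigr => i _ /=.
  rewrite mulmx_sumr linear_sum; apply: eq_bigr => j _ /=.
  by rewrite -mulmxA mul_rank1 -scalemxAr linearZ /= mxtrace_rank1 expr2.
have M_sym : M^T = M.
  by rewrite linear_sum; apply: eq_bigr => i _; rewrite /= trmx_mul trmxK.
have tr_ge0 (A : 'M[R]_d) : A^T = A -> 0 <= \tr (A *m A).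
  move=> A_sym; apply: sumr_ge0 => a _; rewrite mxE; apply: sumr_ge0 => b _.
  by rewrite -{2}A_sym mxE -expr2 sqr_ge0.
(* The trace of the square of d M - tr(M) I is d (d tr(M^2) - tr(M)^2). *)
have := tr_ge0 (d%:R *: M - (\tr M)%:M).
rewrite linearB linearZ /= M_sym tr_scalar_mx => /(_ erefl).
rewrite mulmxBl !mulmxBr !mul_scalar_mx !mul_mx_scalar -!scalemxAl -!scalemxAr.
rewrite !(linearB, linearZ) /= mxtrace_scalar -trM -trM2 -mulr_natl.
have d_gt0 : 0 < d%:R :> R by rewrite ltr0n.
move=> h; rewrite -(ler_pM2l d_gt0) -subr_ge0; apply: le_trans h _.
by rewrite le_eqVlt; apply/orP; left; apply/eqP; ring.
Qed.

(** * Inner products in the absence of special triangles *)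

Section NoSpecialTriangle.
Context {R : realType} {n : nat} {Y : set 'rV[R]_n}.
Hypothesis Y_unit : forall y, Y y -> dot y y = 1.
Hypothesis Y_opp : forall y, Y y -> Y (- y).
Hypothesis Y_dot : forall y z, Y y -> Y z -> 
  [\/ y = z, y = - z | dot y z \in [:: 1 / 5; - (1 / 5); 3 / 5; - (3 / 5)]].
Hypothesis Y_no_special : ~ has_special_triangle Y.

(** The value -1/5 makes [y], [x], [z] special, and -3/5 makes |y + z - 6/5 x|^2 negative. *)
Lemma neighbours_dot x y z : Y x -> Y y -> Y z -> y <> z ->
  dot x y = 3 / 5 -> dot x z = 3 / 5 -> dot y z = 1 / 5 \/ dot y z = 3 / 5.
Proof.
move=> Yx Yy Yz yz xy xz.
case: (Y_dot Yy Yz) => [//|yNz|].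
  by move: xy; rewrite yNz dotNr xz; lra.
rewrite !inE => /or4P[]/eqP yzE; [by left| |by right|].
  by case: Y_no_special; exists y, x, z; split=> //; split; rewrite // dotC.
have := dot_ge0 (y + z - (6 / 5) *: x).
rewrite !dotE (Y_unit Yx) (Y_unit Yy) (Y_unit Yz) (dotC z y) (dotC y x) (dotC z x) xy xz yzE; lra.
Qed.

(** Among the admissible values, a difference of 4/5 or -4/5 yields a special triangle with [z] or
    [- z], and 6/5 or -6/5 makes |x - y - 6/5 w|^2 negative for w = z or w = -z. The factor 5/2 is
    the squared scaling. *)
Lemma root_dot x y z : Y x -> Y y -> Y z -> dot x y = 3 / 5 ->
  5 / 2 * (dot x z - dot y z) \in [:: 0; 1; -1].
Proof.
move=> Yx Yy Yz xy; rewrite !inE.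
have YNz := Y_opp Yz.
have noP u v w : Y u -> Y v -> Y w -> dot u v = 3 / 5 -> dot v w = 3 / 5 -> dot u w <> - (1 / 5).
  by move=> Yu Yv Yw uv vw uw; apply: Y_no_special; exists u, v, w.
have yx : dot y x = 3 / 5 by rewrite dotC.
have gram w : Y w -> dot x w - dot y w <> 6 / 5.
  move=> Yw xyw; have := dot_ge0 (x - y - (6 / 5) *: w).
  rewrite !dotE (Y_unit Yx) (Y_unit Yy) (Y_unit Yw) (dotC w x) (dotC w y) xy yx; lra.
have h1 := noP y x z Yy Yx Yz yx; have h2 := noP x y z Yx Yy Yz xy.
have h3 := noP y x (- z) Yy Yx YNz yx; have h4 := noP x y (- z) Yx Yy YNz xy.
have h5 := gram z Yz; have h6 := gram (- z) YNz.
rewrite !dotNr in h3 h4 h6.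
have value (a b : R) : a = b -> a == b by move=> ->.
case: (Y_dot Yx Yz) => [<-|xz|].
- by rewrite (Y_unit Yx) yx; apply/orP; right; apply/orP; left; apply/eqP; lra.
- have -> : z = - x by rewrite xz opprK.
  by rewrite !dotNr (Y_unit Yx) yx; apply/orP; right; apply/orP; right; apply/eqP; lra.
case: (Y_dot Yy Yz) => [<-|yz|].
- by rewrite (Y_unit Yy) xy => _; apply/orP; right; apply/orP; right; apply/eqP; lra.
- have -> : z = - y by rewrite yz opprK.
  by rewrite !dotNr (Y_unit Yy) xy => _; apply/orP; right; apply/orP; left; apply/eqP; lra.
rewrite !inE => /or4P[]/eqP yzE /or4P[]/eqP xzE; rewrite xzE yzE in h1 h2 h3 h4 h5 h6 *;
  solve [ by apply/orP; left; apply/eqP; lra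
        | by apply/orP; right; apply/orP; left; apply/eqP; lra
        | by apply/orP; right; apply/orP; right; apply/eqP; lra
        | exfalso; by [apply: h1; lra | apply: h2; lra | apply: h3; lra | apply: h4; lra
          | apply: h5; lra | apply: h6; lra] ].
Qed.

End NoSpecialTriangle.

(** * Half-integral coordinates and parity *)

Lemma half_coordinates (R : realType) (a : 'I_10 -> R) :
  (forall i j, i != j -> a i + a j \in [:: 0; 1; -1]) -> \sum_i a i ^+ 2 = 5 / 2 ->
  forall i, a i = 1 / 2 \/ a i = - (1 / 2).
Proof.
move=> a_add a_norm.
have int_add i j : i != j -> a i + a j \is a Num.int.
  by move/a_add; rewrite !inE => /or3P[]/eqP->; rewrite ?rpredN ?rpred1 ?rpred0.
have int_half : (1 / 2 : R) \isn't a Num.int.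
  apply/negP => half; have := norm_intr_ge1 half; rewrite ger0_norm; last by lra.
  by move=> /(_ _); have : (1 / 2 : R) != 0 by [lra]; move=> H /(_ H); lra.
have int2 i : 2 * a i \is a Num.int.
  have jk : lift i ord0 != lift i ord_max by rewrite (inj_eq lift_inj).
  have -> : 2 * a i = (a i + a (lift i ord0)) + (a i + a (lift i ord_max))
      - (a (lift i ord0) + a (lift i ord_max)) by ring.
  apply: rpredB; last exact: int_add.
  by apply: rpredD; apply: int_add; exact: neq_lift.
(* One integral coordinate would make all of them integral, and with them the sum of squares 5/2. *)
have no_int i : a i \isn't a Num.int.
  apply/negP => ai; have int_a j : a j \is a Num.int.
    have [->//|ij] := eqVneq j i.
    by rewrite -[a j](addrK (a i)) rpredB // int_add.
  have : (5 / 2 - 2 : R) \is a Num.int.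
    by rewrite rpredB ?rpred_nat // -a_norm rpred_sum // => j _; rewrite rpredX.
  by rewrite (_ : 5 / 2 - 2 = 1 / 2) ?(negPf int_half) //; lra.
(* Each [2 * a i] is a nonzero integer, so each square is at least 1/4, and the total 10/4 forces
   equality. *)
have sq_ge i : i \in 'I_10 -> 0 <= a i ^+ 2 - 1 / 4.
  move=> _; have : 1 <= `|2 * a i|.
    apply: norm_intr_ge1 => //; apply: contraNneq (no_int i) => ai0.
    by have -> : a i = 0 by lra.
  by rewrite ler_normr => /orP[]; nra.
have : \sum_i (a i ^+ 2 - 1 / 4) = 0.
  rewrite sumrB a_norm sumr_const card_ord -mulr_natr; lra.
move=> /(psumr_eq0P sq_ge) H i.
have /eqP : (a i - 1 / 2) * (a i + 1 / 2) = 0 by rewrite -(H i isT); lra.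
by rewrite mulf_eq0 => /orP[]/eqP ?; [left|right]; lra.
Qed.

(** With [m] positive entries the sum is 2m - 10, and the listed values are those congruent to 2
    modulo 4. *)
Lemma even_card_pos (R : realType) (a : 'I_10 -> R) :
  (forall i, a i = 1 \/ a i = -1) ->
  \sum_i a i \in [:: 2; -2; 6; -6; 10; -10] ->
  ~~ odd #|[set i : 'I_10 | 0 < a i]|.
Proof.
move=> a1; set m := #|_|.
have -> : \sum_i a i = 2 * m%:R - 10.
  rewrite (eq_bigr (fun i => 2 * (0 < a i)%R%:R - 1)); last first.
    by move=> i _; case: (a1 i) => ->; rewrite ?ltr01 ?ltr0N1 ?oppr_gt0 ?ltr10 /=; lra.
  rewrite sumrB -mulr_sumr sumr_const card_ord; congr (2 * _ - _).
  by rewrite -natr_sum -big_mkcond sum1_card /m cardsE.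
have eqm (k : nat) : 2 * m%:R - 10 = 2 * k%:R - 10 :> R -> m = k.
  by move=> mk; apply/eqP; rewrite -(eqr_nat R); apply/eqP; lra.
rewrite !inE => /orP[/eqP E|/orP[/eqP E|/orP[/eqP E|/orP[/eqP E|/orP[]/eqP E]]]];
  [rewrite (eqm 6%N)|rewrite (eqm 4%N)|rewrite (eqm 8%N)|rewrite (eqm 2%N)
  |rewrite (eqm 10%N)|rewrite (eqm 0%N)] => //; lra.
Qed.

(** * Orthonormal bases *)

Section Orthonormal.
Context {R : realType} {n : nat} {e : 'I_n -> 'rV[R]_n}.
Hypothesis e_orth : forall i j, dot (e i) (e j) = (i == j)%:R.

Lemma orthonormal_mx : orthogonal_mx (\matrix_i e i)^T.
Proof.
rewrite /orthogonal_mx trmxK; apply: mulmx1C; apply/matrixP => i j.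
by rewrite !mxE -e_orth; apply: eq_bigr => k _; rewrite !mxE.
Qed.

Lemma parseval u v : dot u v = \sum_i dot u (e i) * dot v (e i).
Proof.
set E := (\matrix_i e i)^T.
have dot_mx w z : dot w z = (w *m z^T) ord0 ord0.
  by rewrite mxE; apply: eq_bigr => k _; rewrite mxE.
transitivity (dot (u *m E) (v *m E)).
  by rewrite !dot_mx trmx_mul mulmxA -(mulmxA u) orthonormal_mx mulmx1.
by apply: eq_bigr => i _; rewrite !dot_row_mul !rowK.
Qed.

End Orthonormal.

(** * The basis in which all vectors become even sign vectors *)

Lemma sign_basis (R : realType) (Y : set 'rV[R]_10) (f : 'I_256 -> 'rV[R]_10) :
  (forall y, Y y -> dot y y = 1) -> (forall y, Y y -> Y (- y)) ->
  (forall y z, Y y -> Y z ->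
    [\/ y = z, y = - z | dot y z \in [:: 1 / 5; - (1 / 5); 3 / 5; - (3 / 5)]]) ->
  ~ has_special_triangle Y ->
  (forall i, Y (f i)) -> (forall i j, i != j -> f i <> f j /\ f i <> - f j) ->
  exists e : 'I_10 -> 'rV[R]_10, (forall i j, dot (e i) (e j) = (i == j)%:R) /\
    forall y, Y y ->
      (forall i, Num.sqrt 10 * dot y (e i) = 1 \/ Num.sqrt 10 * dot y (e i) = -1) /\
      ~~ odd #|[set i | 0 < Num.sqrt 10 * dot y (e i)]|.
Proof.
move=> Y_unit Y_opp Y_dot Y_no_special Yf f_neq.
have f_dot i j : i != j -> dot (f i) (f j) \in [:: 1 / 5; - (1 / 5); 3 / 5; - (3 / 5)].
  by move/f_neq => [ij ijN]; case: (Y_dot _ _ (Yf i) (Yf j)).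
pose A i := [set j | dot (f i) (f j) ^+ 2 == 9 / 25].
have [i Ai] : exists i, (45 <= #|A i|)%N.
  case: (boolP [exists i, (45 <= #|A i|)%N]) => [/existsP //|].
  rewrite negb_exists => /forallP small; exfalso.
  have := welch_bound f.
  rewrite (eq_bigr (fun=> 1)) => [|i _]; last exact: Y_unit.
  rewrite sumr_const card_ord.
  (* With at most 44 indices in [A i], a row sums to at most (256 + 8 * 44 + 24)/25 = 632/25, while
     the Welch bound would need 256 <= 10 * 632/25 = 252.8. *)
  have : \sum_i \sum_j dot (f i) (f j) ^+ 2 <= \sum_(i < 256) 632 / 25.
    apply: ler_sum => i _.
    have sq_le j : dot (f i) (f j) ^+ 2 <= 1 / 25 + 8 / 25 * (j \in A i)%:R + 24 / 25 * (j == i)%:R.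
      have [->|ji] := eqVneq j i.
        by rewrite Y_unit //; case: (i \in A i); rewrite /=; lra.
      rewrite inE; have := f_dot i j; rewrite eq_sym => /(_ ji).
      by rewrite !inE => /or4P[]/eqP ->; case: eqP => /= ?; lra.
    apply: le_trans (ler_sum _ (fun j _ => sq_le j)) _.
    rewrite !big_split /= -!mulr_sumr sumr_const card_ord -natr_sum -big_mkcond sum1_card.
    rewrite (bigD1 i) //= eqxx big1 => [|j /negPf -> //]; rewrite -mulr_natr.
    have : (#|A i|%:R <= 44 :> R) by rewrite ler_nat -ltnS ltnNge small.
    move=> A_le /=; lra.
  by rewrite sumr_const card_ord -[_ / _ *+ _]mulr_natr; lra.
pose h (k : 'I_45) : 'I_256 := enum_val (widen_ord Ai k).
have h_inj : injective h.
  by move=> k l /enum_val_inj/(congr1 val)/= kl; apply: val_inj.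
have h_dot k : dot (f i) (f (h k)) ^+ 2 = 9 / 25.
  by have := enum_valP (widen_ord Ai k); rewrite inE => /eqP.
(* The sign turns each inner product with [x] into +3/5. *)
pose x := f i; pose y k := (-1) ^+ (dot x (f (h k)) < 0)%R *: f (h k).
have yE k : y k = f (h k) \/ y k = - f (h k).
  by rewrite /y; case: (_ < _); rewrite ?scaleN1r ?scale1r; [right|left].
have Yx : Y x := Yf i.
have Yy k : Y (y k) by case: (yE k) => ->; [|apply: Y_opp].
have xy k : dot x (y k) = 3 / 5.
  have : (dot x (f (h k)) - 3 / 5) * (dot x (f (h k)) + 3 / 5) = 0.
    by have := h_dot k; rewrite -/x; lra.
  rewrite /y dotZr => /eqP; rewrite mulf_eq0 => /orP[]/eqP ?; case: ltP => /= ?; rewrite ?expr1 ?expr0; lra.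
have y_neq k l : k != l -> y k <> y l.
  rewrite -(inj_eq h_inj) => /f_neq[kl klN].
  case: (yE k) => ->; case: (yE l) => -> // [E].
    by case: klN; rewrite -E opprK.
  by case: kl; apply: oppr_inj.
clearbody y.
have s2 : (Num.sqrt 10 / 2) ^+ 2 = 5 / 2 :> R.
  by rewrite exprMn sqr_sqrtr ?ler0n //; lra.
set s : R := Num.sqrt 10 / 2 in s2.
have sdot u v : dot (s *: u) (s *: v) = 5 / 2 * dot u v.
  by rewrite dotZl dotZr mulrA -expr2 s2.
pose r k := s *: x - s *: y k.
(* For distinct [k], [l] the roots have inner product 5/2 ((y_k, y_l) - 1/5), which is 1 for 3/5 and
   0 for 1/5. *)
pose g k l : nat := if k == l then 2%N else (dot (y k) (y l) == 3 / 5).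
have x_norm : dot (s *: x) (s *: x) = 5 / 2 by rewrite sdot Y_unit ?mulr1.
have rx k : dot (r k) (s *: x) = 1.
  by rewrite dotBl !sdot (dotC _ x) Y_unit // xy; lra.
have rr k l : dot (r k) (r l) = (g k l)%:R.
  rewrite dotBl !dotBr !sdot (dotC _ x) !xy Y_unit // /g.
  have [->|kl] := eqVneq k l; first by rewrite Y_unit //; lra.
  by case: (neighbours_dot Y_unit Y_dot Y_no_special Yx (Yy k) (Yy l) (y_neq _ _ kl) (xy k) (xy l)) => ->;
    case: eqP => /= ?; lra.
have [k|k l /negPf kl|e [e_orth e_x e_root]] := root_basis x_norm rx rr.
- by rewrite /g eqxx.
- by rewrite /g kl leq_b1.
exists e; split=> // z Yz.
pose a j := s * dot z (e j).
have a_half : forall j, a j = 1 / 2 \/ a j = - (1 / 2).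
  apply: half_coordinates => [j j' /e_root[k rk]|].
    rewrite /a -mulrDr -dotDr -rk dotBr !dotZr -mulrBr mulrA -expr2 s2 !(dotC z).
    exact: (root_dot Y_unit Y_opp Y_dot Y_no_special Yx (Yy k) Yz (xy k)).
  rewrite -[5 / 2]mulr1 -s2 -(Y_unit z Yz) (parseval e_orth) mulr_sumr.
  by apply: eq_bigr => j _; rewrite /a; ring.
have two_a j : Num.sqrt 10 * dot z (e j) = 2 * a j by rewrite /a /s; lra.
have sign j : Num.sqrt 10 * dot z (e j) = 1 \/ Num.sqrt 10 * dot z (e j) = -1.
  by rewrite two_a; case: (a_half j) => ->; [left|right]; lra.
split=> //; apply: even_card_pos => //.
(* All coordinates of [s *: x] are 1/2, so the coordinate sum of [z] is read off from its inner
   product with [x]. *)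
have -> : \sum_j Num.sqrt 10 * dot z (e j) = 10 * dot z x.
  rewrite (_ : 10 * dot z x = 4 * (5 / 2 * dot z x)); last by lra.
  rewrite -sdot (parseval e_orth) mulr_sumr; apply: eq_bigr => j _.
  by rewrite (dotC (s *: x)) e_x two_a /a dotZl; lra.
case: (Y_dot _ _ Yz Yx) => [->|->|].
- by rewrite Y_unit // mulr1 !inE eqxx !orbT.
- by rewrite dotNl Y_unit // mulrN1 !inE eqxx !orbT.
have [h2 h6] : 10 * (1 / 5) = 2 :> R /\ 10 * (3 / 5) = 6 :> R by split; lra.
by rewrite !inE => /or4P[]/eqP ->; rewrite ?mulrN ?h2 ?h6 eqxx ?orbT.
Qed.

(** * Counting even sign vectors *)

Definition even_sign_vector (R : realType) (a : 'I_10 -> R) : Prop :=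
  [/\ a ord0 = 1, forall i, a i = 1 \/ a i = -1 & ~~ odd #|[set i | 0 < a i]|].

(** The first coordinate is fixed and the last one, [m], is recovered from the parity, which leaves
    eight free signs. *)
Lemma even_sign_vector_inj (R : realType) (a b : 'I_10 -> R) :
  even_sign_vector a -> even_sign_vector b ->
  (forall k : 'I_8, (0 < a (lift ord0 (lift ord_max k))) = (0 < b (lift ord0 (lift ord_max k)))) ->
  a =1 b.
Proof.
move=> [a0 a1 a_even] [b0 b1 b_even] ab; set m := lift ord0 (ord_max : 'I_9).
have pos_eq i : i != m -> (0 < a i) = (0 < b i).
  case: (unliftP ord0 i) => [j|] -> im; last by rewrite a0 b0.
  case: (unliftP ord_max j) im => [k|] -> //; by rewrite eqxx.
have pos_m : (0 < a m) = (0 < b m).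
  have setE : [set i | 0 < a i] :\ m = [set i | 0 < b i] :\ m.
    by apply/setP => i; rewrite !inE; case: eqVneq => //= /pos_eq.
  move: a_even b_even; rewrite (cardsD1 m [set i | 0 < a i]) (cardsD1 m [set i | 0 < b i])
    setE !inE !oddD !oddb.
  by case: (0 < a m); case: (0 < b m); case: (odd _).
move=> i; have : (0 < a i) = (0 < b i) by have [->|/pos_eq] := eqVneq i m.
by case: (a1 i) => ->; case: (b1 i) => ->; rewrite ?ltr01 ?ltr0N1 ?oppr_gt0 ?ltr10.
Qed.

(** Since 256 = 2^8, pairwise distinct even sign vectors exhaust all sign patterns. *)
Lemma even_sign_vectors_onto (R : realType) (w : 'I_256 -> 'I_10 -> R) :
  (forall k, even_sign_vector (w k)) -> (forall k l, w k =1 w l -> k = l) ->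
  forall a, even_sign_vector a -> exists k, w k =1 a.
Proof.
move=> w_even w_inj a a_even.
pose code (b : 'I_10 -> R) : {ffun 'I_8 -> bool} := [ffun k => 0 < b (lift ord0 (lift ord_max k))].
have code_inj b c : even_sign_vector b -> even_sign_vector c -> code b = code c -> b =1 c.
  move=> b_even c_even /ffunP bc; apply: even_sign_vector_inj => // k.
  by have := bc k; rewrite !ffunE.
have /inj_card_onto onto : injective (code \o w) by move=> k l /code_inj kl; apply/w_inj/kl.
have /codomP[k ak] : code a \in codom (code \o w).
  by apply: onto; rewrite card_ffun card_bool !card_ord.
by exists k; apply: code_inj => //; rewrite ak.
Qed.

(** * The equivalence with [X10] *)

Lemma unit_sphereE (R : realType) n (x : 'rV[R]_n) : unit_sphere x -> dot x x = 1.
Proof. by rewrite /unit_sphere /enorm /= => x1; rewrite -[LHS]sqr_sqrtr ?dot_ge0 // x1 expr1n. Qed.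

Local Open Scope classical_set_scope.
Local Open Scope card_scope.
Local Open Scope ring_scope.

Theorem proposition7p2 (R : realType) (X : set 'rV[R]_10)
    (X_sphere : X `<=` unit_sphere)
    (X_inner : inner_products X `<=` [set 1 / 5; - (1 / 5); 3 / 5; - (3 / 5)])
    (X_card : `I_256 #<= X)
    (X_no_special : ~ has_special_triangle (sym_closure X)) :
  equivalent X (X10 R).
Proof.
have X_unit x : X x -> dot x x = 1 by move/X_sphere/unit_sphereE.
have X_dot x y : X x -> X y ->
    x = y \/ dot x y \in [:: 1 / 5; - (1 / 5); 3 / 5; - (3 / 5)].
  move=> Xx Xy; have [->|xy] := eqVneq x y; [by left|right].
  have : inner_products X (dot x y) by exists x, y.
  by move/X_inner => [[[]|]|] /= ->; rewrite !inE eqxx ?orbT.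
have Y_cases y : sym_closure X y -> X y \/ exists2 x, X x & y = - x.
  by case=> [|[x Xx <-]]; [left|right; exists x].
have Y_X x : X x -> sym_closure X x by left.
have Y_NX x : X x -> sym_closure X (- x) by right; exists x.
have Y_unit y : sym_closure X y -> dot y y = 1.
  by move=> /Y_cases[/X_unit|[x /X_unit x1 ->]] //; rewrite dotNl dotNr opprK.
have Y_opp y : sym_closure X y -> sym_closure X (- y).
  by move=> /Y_cases[/Y_NX|[x /Y_X Yx ->]] //; rewrite opprK.
have dotN_in (t : R) : t \in [:: 1 / 5; - (1 / 5); 3 / 5; - (3 / 5)] ->
    - t \in [:: 1 / 5; - (1 / 5); 3 / 5; - (3 / 5)].
  by rewrite !inE => /or4P[]/eqP->; rewrite ?opprK eqxx ?orbT.
have Y_dot y z : sym_closure X y -> sym_closure X z ->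
    [\/ y = z, y = - z | dot y z \in [:: 1 / 5; - (1 / 5); 3 / 5; - (3 / 5)]].
  move=> /Y_cases[Xy|[y' Xy ->]] /Y_cases[Xz|[z' Xz ->]];
    case: (X_dot _ _ Xy Xz) => [->|yz]; rewrite ?opprK ?dotNl ?dotNr;
    by [constructor 1|constructor 2|constructor 3; rewrite ?opprK ?dotN_in].
have X_opp x y : X x -> X y -> x <> - y.
  move=> Xx Xy xNy; case: (X_dot _ _ Xx Xy) => [xy|].
    by have := X_unit x Xx; rewrite {1}xNy -xy dotNl X_unit //; lra.
  by rewrite xNy dotNl X_unit // !inE => /or4P[]/eqP; lra.
have /card_leP[F] := X_card.
have I256 (i : 'I_256) : (i : nat) \in `I_256 by apply/mem_set/ltn_ord.
pose f (i : 'I_256) : 'rV[R]_10 := set_val (F (SigSub (I256 i))).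
have Xf i : X (f i) by apply: set_valP.
have f_inj i j : f i = f j -> i = j.
  move/val_inj/(inj (mem_set I) (mem_set I))/(congr1 set_val) => ij.
  exact: val_inj.
have f_neq i j : i != j -> f i <> f j /\ f i <> - f j.
  by move=> /eqP ij; split; [move/f_inj|apply: X_opp].
have [e [e_orth e_sign]] :=
  sign_basis Y_unit Y_opp Y_dot X_no_special (fun i => Y_X _ (Xf i)) f_neq.
(* Flipping these vectors makes the first coordinate positive, as in [X10]. *)
pose s x := dot x (e ord0) < 0.
pose Q := (\matrix_i e i)^T.
have QE x i : ((-1) ^+ s x *: (x *m Q)) ord0 i = dot ((-1) ^+ s x *: x) (e i).
  by rewrite scalemxAl dot_row_mul rowK.
have Ys x : X x -> sym_closure X ((-1) ^+ s x *: x).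
  by case: (s x); rewrite ?scaleN1r ?scale1r; [apply: Y_NX|apply: Y_X].
pose w x i : R := Num.sqrt 10 * dot ((-1) ^+ s x *: x) (e i).
have sqrt10 : 0 < Num.sqrt 10 :> R by rewrite sqrtr_gt0 ltr0n.
have w_even x : X x -> even_sign_vector (w x).
  move=> /[dup] Xx /Ys/e_sign[w1 w_even]; split=> //.
  have [//|] := w1 ord0; rewrite dotZl /s.
  case: ltP => [neg|pos]; rewrite ?expr1 ?expr0 => E; exfalso; nra.
have w_inj i j : w (f i) =1 w (f j) -> i = j.
  move=> wij; apply: f_inj.
  have : (-1) ^+ s (f i) *: f i = (-1) ^+ s (f j) *: f j.
    apply: dot_inj => u; rewrite !(parseval e_orth u); apply: eq_bigr => k _.
    by congr (_ * _); apply: (mulfI (lt0r_neq0 sqrt10)); exact: wij.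
  case: (s (f i)); case: (s (f j)); rewrite ?scaleN1r ?scale1r => // E.
  - exact: oppr_inj.
  - by case: (X_opp _ _ (Xf j) (Xf i)).
  - by case: (X_opp _ _ (Xf i) (Xf j)).
have image_w x : (-1) ^+ s x *: (x *m Q) = (Num.sqrt 10)^-1 *: \row_i w x i.
  apply/rowP => i; rewrite QE 2!mxE mulrA mulVf ?mul1r //.
  exact: lt0r_neq0.
exists Q, s; split; first exact: orthonormal_mx.
(* That every vector of [X10] is reached follows by counting the images of the 256 vectors [f k];
   the converse inclusion is [w_even]. *)
apply/seteqP; split=> [v [a [a0 a1 a_even]] <-|v [x Xx <-]].
  have [k wa] := even_sign_vectors_onto (fun k => w_even _ (Xf k)) w_inj (And3 a0 a1 a_even).
  by exists (f k) => //; rewrite image_w; congr (_ *: _); apply/rowP => i; rewrite mxE wa.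
have [w0 w1 w_ev] := w_even x Xx.
exists (\row_i w x i); last by rewrite image_w.
split=> [|i|]; rewrite ?mxE //.
by under eq_finset do rewrite mxE.
Qed.
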